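(* Let $d\ge 1$ and $M=(m_1,\ldots,m_d)\in(\mathbb{Z}_{\ge 3})^d$, and put $\Vert M\Vert=m_1\cdots m_d$. Let $N^{(d)}_M(n)$ be the number of reduced cycles of length $n$ in the discrete torus $\mathrm{DT}^{(d)}_M$. Then, for every integer $n\ge 3$, $$N^{(d)}_{M}(n)=\Vert M\Vert\sum_{\substack{0\le h\le n\\ h\equiv n \ (\mathrm{mod}\ 2)}}\ \sum_{z\in R^{(d)}_M(h)}m^{(d)}_{M}(z)\,X^{(d)}_{M,h}(n;z),$$ where, for $h\in\mathbb{Z}_{\ge 0}$, $R^{(d)}_M(h)$ is the finite set of all $z=(z_1,\ldots,z_d)\in(\mathbb{Z}_{\ge 0})^d$ such that $z_1\ge\cdots\ge z_d$, $|z|=z_1+\cdots+z_d=h$, and there exists $(y_1,\ldots,y_d)\in\mathbb{Z}^d$ with $\{z_1,\ldots,z_d\}=\{m_1|y_1|,\ldots,m_d|y_d|\}$ as multisets; for $z\in R^{(d)}_M(h)$, $$m^{(d)}_{M}(z)=\#\bigl\{(y_1,\ldots,y_d)\in\mathbb{Z}^d \,:\, \{z_1,\ldots,z_d\}=\{m_1|y_1|,\ldots,m_d|y_d|\}\text{ as multisets}\bigr\};$$ and $$X^{(d)}_{M,h}(n;z)=2(d-1)\delta_{h,0}+\frac{2n\bigl(-(2d-1)\bigr)^{\frac{n-h}{2}}}{n+h}\binom{h}{z_1,\ldots,z_d}P^{(z,-1)}_{d,\frac{n-h}{2}}\Bigl(\frac{2d-3}{2d-1}\Bigr).$$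
   Context: Discrete torus: for $M=(m_1,\ldots,m_d)\in(\mathbb{Z}_{\ge 3})^d$, $\mathrm{DT}^{(d)}_M$ is the Cayley graph of the group $\prod_{j=1}^d\mathbb{Z}/m_j\mathbb{Z}$ with respect to the generating set $\{\pm\delta_1,\ldots,\pm\delta_d\}$, where $\delta_j=(0,\ldots,0,1,0,\ldots,0)$ has its $1$ in the $j$-th position. It is a simple connected $2d$-regular graph. Reduced cycles: a cycle $C$ of length $l(C)=n\ge1$ in a graph is a closed walk $e_1e_2\cdots e_n$ of directed edges (each edge of the graph gives two directed edges, inverse to each other; the starting vertex and the direction are part of the data). It is reduced if $C^2$ ($C$ traversed twice) has no backtrack, i.e. $e_{i+1}\ne e_i^{-1}$ for $1\le i\le n-1$ and $e_1\neq e_n^{-1}$. Generalized Jacobi polynomial: for $\alpha=(\alpha_1,\ldots,\alpha_d)\in\mathbb{R}^d$ (no $\alpha_j$ a negative integer), $\beta\in\mathbb{R}$, $k\in\mathbb{Z}_{\ge0}$, with $|\alpha|=\alpha_1+\cdots+\alpha_d$, $$P^{(\alpha,\beta)}_{d,k}(x)=\frac{(|\alpha|+1)_k}{k!}\,F^{(d)}_C\left(\begin{array}{c}-k,\ k+|\alpha|+\beta+1\\ \alpha_1+1,\ldots,\alpha_d+1\end{array};\frac{1-x}{2},\ldots,\frac{1-x}{2}\right),$$ where $$F^{(d)}_C\left(\begin{array}{c}a,b\\ c_1,\ldots,c_d\end{array};x_1,\ldots,x_d\right)=\sum_{n=(n_1,\ldots,n_d)\in(\mathbb{Z}_{\ge0})^d}\frac{(a)_{|n|}(b)_{|n|}}{(c_1)_{n_1}\cdots(c_d)_{n_d}}\frac{x_1^{n_1}}{n_1!}\cdots\frac{x_d^{n_d}}{n_d!}$$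 is the Lauricella hypergeometric function of type $C$ and $(a)_k=a(a+1)\cdots(a+k-1)$ is the Pochhammer symbol. When $a=-k$ the series terminates, so $P^{(\alpha,\beta)}_{d,k}(x)$ is a polynomial in $x$, defined for every $x$ by the finite sum over $|n|\le k$. Also $\delta_{h,0}$ is the Kronecker delta and $\binom{h}{z_1,\ldots,z_d}=\frac{h!}{z_1!\cdots z_d!}$. *)

(* Defs.v *)
From HB Require Import structures.
From mathcomp Require Import all_boot all_order all_fingroup all_algebra.
From mathcomp Require Import finmap boolp classical_sets functions cardinality.
From mathcomp Require Import fsbigop.

Set Implicit Arguments.
Unset Strict Implicit.
Unset Printing Implicit Defensive.

Import Order.TTheory GRing.Theory Num.Theory.

Local Open Scope classical_set_scope.
Local Open Scope ring_scope.

(* A directed edge of the simple graph (V, e) is a pair (origin, terminus). *)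
Definition is_dedge (V : finType) (e : rel V) : pred (V * V) :=
  fun a => e a.1 a.2.

Definition dedge_inv (V : finType) (a : V * V) : V * V := (a.2, a.1).

Definition dedge_next (V : finType) : rel (V * V) := fun a b => a.2 == b.1.

Definition no_backtrack (V : finType) : rel (V * V) :=
  fun a b => b != dedge_inv a.

(* [path.cycle] tests all consecutive pairs of the sequence, including the pair
   (last, first); both the closing condition and e_1 != e_n^-1 are therefore
   covered.  For n = 1 the only pair is (e_1, e_1).  The definition is meant
   for n >= 1. *)
Definition is_reduced_cycle (V : finType) (e : rel V) (n : nat)
    (c : n.-tuple (V * V)) : bool :=
  [&& all (is_dedge e) c, path.cycle (@dedge_next V) c
    & path.cycle (@no_backtrack V) c].

Definition num_reduced_cycles (V : finType) (e : rel V) (n : nat) : nat :=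
  #|[set c : n.-tuple (V * V) | is_reduced_cycle e c]%SET|.

Definition cayley_rel (gT : finGroupType) (S : {set gT}) : rel gT :=
  fun u v => (u^-1 * v)%g \in S.

(* 'Z_m is Z/mZ for m >= 2; as a finGroupType it is the additive group. *)
Definition Zmod (m : nat) : finGroupType := 'Z_m.

Definition torus (d : nat) (M : 'I_d -> nat) : finGroupType :=
  {dffun forall j : 'I_d, Zmod (M j)}.

(* [dfung1 x] has coordinate x at index j and the neutral element elsewhere. *)
Definition torus_delta (d : nat) (M : 'I_d -> nat) (j : 'I_d) : torus M :=
  @dfung1 'I_d (fun i => Zmod (M i)) j (1 : 'Z_(M j))%R.

Definition torus_gens (d : nat) (M : 'I_d -> nat) : {set torus M} :=
  [set torus_delta M j | j : 'I_d]%SET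
    :|: [set (torus_delta M j)^-1%g | j : 'I_d]%SET.

Definition discrete_torus (d : nat) (M : 'I_d -> nat) : rel (torus M) :=
  cayley_rel (torus_gens M).
Arguments discrete_torus {d} M u v.

Definition Ncycles (d : nat) (M : 'I_d -> nat) (n : nat) : nat :=
  num_reduced_cycles (discrete_torus M) n.

Definition pochhammer (F : fieldType) (a : F) (k : nat) : F :=
  \prod_(i < k) (a + i%:R).

Definition lauricellaC_term (F : fieldType) (d : nat) (a b : F)
    (c x : 'I_d -> F) (n : 'I_d -> nat) : F :=
  pochhammer a (\sum_j n j)%N * pochhammer b (\sum_j n j)%N
    / (\prod_j pochhammer (c j) (n j))
    * \prod_j (x j ^+ n j / (n j)`!%:R).

(* The partial sum of the Lauricella series over |n| <= k (each coordinate is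
   then at most k); it is the whole series when a = - k, by the next lemma. *)
Definition lauricellaC_upto (F : fieldType) (d k : nat) (a b : F)
    (c x : 'I_d -> F) : F :=
  \sum_(n : {ffun 'I_d -> 'I_k.+1} | (\sum_j n j <= k)%N)
    lauricellaC_term a b c x (fun j => n j : nat).

Lemma lauricellaC_term_eq0 (F : fieldType) (d k : nat) (b : F)
    (c x : 'I_d -> F) (n : 'I_d -> nat) :
  (k < \sum_j n j)%N -> lauricellaC_term (- k%:R) b c x n = 0.
Proof.
move=> lt_k; rewrite /lauricellaC_term /pochhammer.
by rewrite (bigD1 (Ordinal lt_k)) //= addNr !mul0r.
Qed.

Definition gen_jacobi (F : fieldType) (d k : nat) (alpha : 'I_d -> F)
    (beta x : F) : F :=
  let abs_alpha := \sum_j alpha j in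
  pochhammer (abs_alpha + 1) k / k`!%:R
    * lauricellaC_upto k (- k%:R) (k%:R + abs_alpha + beta + 1)
        (fun j => alpha j + 1) (fun=> (1 - x) / 2).

Definition multinomial (F : fieldType) (d h : nat) (z : 'I_d -> nat) : F :=
  h`!%:R / \prod_j (z j)`!%:R.

(* All y in Z^d with {z_1,...,z_d} = {m_1|y_1|,...,m_d|y_d|} as multisets. *)
Definition torus_reps (d : nat) (M : 'I_d -> nat) (z : {ffun 'I_d -> nat}) :
    set {ffun 'I_d -> int} :=
  [set y | perm_eq [seq z j | j : 'I_d] [seq (M j * `|y j|)%N | j : 'I_d]].

Definition torus_R (d : nat) (M : 'I_d -> nat) (h : nat) :
    set {ffun 'I_d -> nat} :=
  [set z : {ffun 'I_d -> nat} |
    [/\ forall i j : 'I_d, (i <= j)%N -> (z j <= z i)%N,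
        (\sum_j z j)%N = h & torus_reps M z !=set0]].

(* [fset_set A] and [\sum_(z \in A)] have their intended meaning on finite sets
   only; the next two lemmas show that they are used on finite sets. *)
Lemma finite_torus_reps (d : nat) (M : 'I_d -> nat) (z : {ffun 'I_d -> nat}) :
  (forall j, 0 < M j)%N -> finite_set (torus_reps M z).
Proof.
move=> M_gt0; pose h := (\sum_j z j)%N.
pose f (w : {ffun 'I_d -> 'I_h.+1 * bool}) : {ffun 'I_d -> int} :=
  [ffun j => if (w j).2 then - (w j).1%:Z else (w j).1%:Z].
apply: (sub_finite_set (B := range f)); last first.
  exact/finite_image/finite_finset.
move=> y yz /=.
exists [ffun j => (inord `|y j|%N, y j < 0)] => //.
apply/ffunP => j; rewrite !ffunE /= inordK.
  by case: ltrP => [/ltr0_norm|/ger0_norm] H; rewrite -abszE in H; rewrite H ?opprK.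
have: (M j * `|y j|)%N \in [seq z i | i : 'I_d].
  by rewrite (perm_mem yz); apply/codomP; exists j.
case/codomP => i zi; rewrite ltnS (leq_trans (leq_pmull _ (M_gt0 j))) // zi.
by rewrite /h (bigD1 i) //= leq_addr.
Qed.

Lemma finite_torus_R (d : nat) (M : 'I_d -> nat) (h : nat) :
  finite_set (torus_R M h).
Proof.
pose f (w : {ffun 'I_d -> 'I_h.+1}) : {ffun 'I_d -> nat} :=
  [ffun j => w j : nat].
apply: (sub_finite_set (B := range f)); last first.
  exact/finite_image/finite_finset.
move=> z [_ zh _]; exists [ffun j => inord (z j)] => //.
apply/ffunP => j; rewrite !ffunE inordK // ltnS -zh.
by rewrite (bigD1 j) //= leq_addr.
Qed.

Definition torus_mult (d : nat) (M : 'I_d -> nat) (z : {ffun 'I_d -> nat}) :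
    nat :=
  #|` fset_set (torus_reps M z)|%fset.

Definition torus_X (F : fieldType) (d h n : nat) (z : {ffun 'I_d -> nat}) : F :=
  2 * (d%:R - 1) * (h == 0%N)%:R
  + 2 * n%:R * (- (2 * d%:R - 1)) ^+ ((n - h)./2) / (n + h)%:R
    * multinomial F h z
    * gen_jacobi (n - h)./2 (fun j => (z j)%:R) (-1)
        ((2 * d%:R - 3) / (2 * d%:R - 1)).

(* Main.v *)
Require Import Defs.
From mathcomp Require Import all_boot all_order all_fingroup all_algebra.
From mathcomp Require Import finmap boolp classical_sets cardinality.
From mathcomp Require Import fsbigop zify ring.

(** The number of reduced cycles of length n is the trace of B ^+ n, where B is
the non-backtracking matrix on directed edges.  Factoring B through the vertices
(B = T O - J, with T and O the terminus and origin incidence matrices and J the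
edge reversal) gives, for a (q+1)-regular graph with adjacency matrix A, the
Ihara-Bass formula in its trace form [trace_nonbacktracking]: tr (B ^+ n) is
tr (D_n(A)), up to an elementary term for even n, where D_n is the Dickson
polynomial characterised by D_n (x + q / x) = x ^ n + (q / x) ^ n.  Its
coefficients are explicit [num_reduced_cycles_regular], so that the count
becomes a linear combination of the traces of the powers A ^+ (n - 2k), that is,
of numbers of closed walks.

On the torus, a closed walk is a base point together with a sequence of steps
whose total displacement in Z^d is (M_j y_j) for some y in Z^d; hence
tr (A ^+ m) is the number of vertices times the sum over y of the number of
m-step walks from 0 to (M_j y_j) in Z^d [torus_closed_walks_int].  The latter is
a sum of multinomial coefficients, indexed by the numbers v_j of cancelling
pairs of steps in each direction j [num_walksE].

It remains to put these together for each y separately.  With h the l1 norm of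
(M_j y_j) and K = (n - h) / 2, the Dickson coefficient of index k meets exactly
the v with |v| = K - k, and the resulting sum over |v| <= K is, term by term,
the Lauricella series of the generalized Jacobi polynomial at
(1 - x) / 2 = 1 / q, where q = 2d - 1 [jacobi_term, sum_dickson_walks].  Since
that polynomial is symmetric in its parameters, the y with the same multiset of
values M_j |y_j| contribute equally; grouping them by the nonincreasing
rearrangement z yields the multiplicity of z [sum_torus_R]. *)

Set Implicit Arguments.
Unset Strict Implicit.
Unset Printing Implicit Defensive.

Import Order.TTheory GRing.Theory Num.Theory.

Local Open Scope ring_scope.

(** * Matrices indexed by finite types, and walks *)

Lemma card_set_sum (T : finType) (P : pred T) :
  #|[set x | P x]| = (\sum_x P x)%N.
Proof.
rewrite cardsE -sum1_card big_mkcond; apply: eq_bigr => x _.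
by rewrite -topredE /=; case: (P x).
Qed.

Section FinMatrix.
Variable R : comNzRingType.

(** Finite types are numbered by [enum_val], so that the ring structure, powers
and traces of ordinary matrices apply to kernels on them. *)
Definition fmx (T U : finType) (f : T -> U -> R) : 'M[R]_(#|T|, #|U|) :=
  \matrix_(i, j) f (enum_val i) (enum_val j).

Lemma eq_fmx (T U : finType) (f g : T -> U -> R) : f =2 g -> fmx f = fmx g.
Proof. by move=> fg; apply/matrixP => i j; rewrite !mxE fg. Qed.

Lemma mulmx_fmx (T U W : finType) (f : T -> U -> R) (g : U -> W -> R) :
  fmx f *m fmx g = fmx (fun x z => \sum_y f x y * g y z).
Proof.
apply/matrixP => i j; rewrite !mxE [RHS]big_enum_val /=.
by apply: eq_bigr => k _; rewrite !mxE.
Qed.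

Lemma addmx_fmx (T U : finType) (f g : T -> U -> R) :
  fmx f + fmx g = fmx (fun x y => f x y + g x y).
Proof. by apply/matrixP => i j; rewrite !mxE. Qed.

Lemma scalar_fmx (T : finType) (a : R) :
  a%:M = fmx (fun x y : T => a *+ (x == y)).
Proof.
by apply/matrixP => i j; rewrite !mxE (inj_eq enum_val_inj).
Qed.

Lemma mxtrace_fmx (T : finType) (f : T -> T -> R) :
  \tr (fmx f) = \sum_x f x x.
Proof.
rewrite /mxtrace [RHS]big_enum_val /=.
by apply: eq_bigr => i _; rewrite mxE.
Qed.

Definition relmx (T U : finType) (r : T -> U -> bool) : 'M[R]_(#|T|, #|U|) :=
  fmx (fun x y => (r x y)%:R).

Lemma sum_tupleS (V : nmodType) (T : finType) (n : nat)
    (F : n.+1.-tuple T -> V) :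
  \sum_t F t = \sum_x \sum_(t : n.-tuple T) F [tuple of x :: t].
Proof.
rewrite pair_bigA /=.
rewrite (reindex (fun p : T * n.-tuple T => [tuple of p.1 :: p.2])) //=.
exists (fun t => (thead t, [tuple of behead t])) => [[x t]|t] _ /=.
  by congr (_, _); apply: val_inj.
by rewrite -tuple_eta.
Qed.

Lemma card_sum_bool (T : finType) (P : pred T) :
  (#|[set x | P x]|)%:R = \sum_x (P x)%:R :> R.
Proof. by rewrite card_set_sum natr_sum. Qed.

(** Only the n vertices following the starting point are recorded in the tuple,
which is what makes the induction on n immediate. *)
Lemma relmxX (T : finType) (r : rel T) (n : nat) :
  relmx r ^+ n =
  fmx (fun x y => (#|[set c : n.-tuple T | path r x c && (last x c == y)]|)%:R).
Proof.
elim: n => [|n IHn].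
  rewrite expr0 [LHS](scalar_fmx T 1); apply: eq_fmx => x y.
  rewrite card_sum_bool (bigD1 [tuple]) //= big1 ?addr0 // => t.
  by rewrite tuple0.
rewrite exprS IHn [LHS]mulmx_fmx; apply: eq_fmx => x y.
rewrite card_sum_bool sum_tupleS; apply: eq_bigr => z _.
rewrite card_sum_bool mulr_sumr; apply: eq_bigr => t _ /=.
by rewrite -andbA; case: (r x z); rewrite ?mul1r ?mul0r.
Qed.

Lemma mxtrace_relmxX (T : finType) (r : rel T) (n : nat) :
  \tr (relmx r ^+ n.+1) =
  (#|[set c : n.+1.-tuple T | path.cycle r c]|)%:R.
Proof.
rewrite exprSr relmxX [X in \tr X]mulmx_fmx mxtrace_fmx card_sum_bool.
rewrite sum_tupleS.
apply: eq_bigr => x _; under eq_bigr do rewrite card_sum_bool mulr_suml.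
rewrite exchange_big /=; apply: eq_bigr => t _.
rewrite (bigD1 (last x t)) //= big1 ?addr0 => [|y /negPf ylast].
  rewrite eqxx andbT rcons_path.
  by case: path; case: r; rewrite /= ?mul1r ?mul0r.
by rewrite eq_sym ylast andbF mul0r.
Qed.

End FinMatrix.

(** * The trace formula for reduced cycles in a regular graph *)

(** The incidence and reversal matrices below are graphs of partial functions:
multiplying by one of them on the left is a substitution, with no sum left. *)
Lemma mulmx_graph (R : comNzRingType) (T U W : finType) (p : pred T)
    (h : T -> U) (g : U -> W -> R) :
  relmx R (fun x y => p x && (y == h x)) *m fmx g =
  fmx (fun x z => (p x)%:R * g (h x) z).
Proof.
rewrite mulmx_fmx; apply: eq_fmx => x z; rewrite (bigD1 (h x)) //= big1.
  by rewrite eqxx andbT addr0.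
by move=> y /negPf ->; rewrite andbF mul0r.
Qed.

Section Darts.
Variables (R : comNzRingType) (V : finType) (e : rel V) (q : nat).
Hypothesis e_sym : symmetric e.
Hypothesis e_irr : irreflexive e.
Hypothesis e_reg : forall x, #|[set y | e x y]| = q.+1.

Definition nonbacktracking : rel (V * V) := fun a b =>
  [&& is_dedge e a, is_dedge e b, dedge_next a b & no_backtrack a b].

(* Darts are all pairs of vertices here, those that are not edges contributing
   zero rows and columns; P is then the projection onto genuine darts, and
   plays the part of the identity matrix. *)
Let A := relmx R e.
Let B := relmx R nonbacktracking.
Let O := relmx R (fun v (a : V * V) => is_dedge e a && (v == a.1)).
Let O' := relmx R (fun (a : V * V) v => is_dedge e a && (v == a.1)).
Let T := relmx R (fun (a : V * V) v => is_dedge e a && (v == a.2)).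
Let J := relmx R (fun a b : V * V => is_dedge e a && (b == dedge_inv a)).
Let P := relmx R (fun a b : V * V => is_dedge e a && (b == a)).

Let natM (b1 b2 : bool) : b1%:R * b2%:R = (b1 && b2)%:R :> R.
Proof. by case: b1; case: b2; rewrite ?mul1r ?mul0r. Qed.

Let dedge_invE (a : V * V) : is_dedge e (dedge_inv a) = is_dedge e a.
Proof. by rewrite /is_dedge /= e_sym. Qed.

Let OT : O *m T = A.
Proof.
rewrite mulmx_fmx; apply: eq_fmx => v w; rewrite (bigD1 (v, w)) //= big1.
  by rewrite !eqxx natM /is_dedge /= !andbT andbb addr0.
case=> x y; rewrite /is_dedge /= natM xpair_eqE andbACA (eq_sym x) (eq_sym y).
by move=> /negPf ->; rewrite andbF.
Qed.

(** Following a dart by any adjacent one is T O; its reverse is among those, and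
it is the only one that J subtracts. *)
Let BE : B = T *m O - J.
Proof.
apply/(canRL (addrK _)); rewrite [RHS]mulmx_graph [LHS]addmx_fmx.
apply: eq_fmx => a b; rewrite natM -natrD; congr (_%:R).
rewrite /nonbacktracking /no_backtrack /dedge_next.
case ea: (is_dedge e a) => //=; have [-> | _] := eqVneq b (dedge_inv a).
  by rewrite dedge_invE ea /= eqxx.
by rewrite andbT addn0.
Qed.

Let JJ : J *m J = P.
Proof.
rewrite mulmx_graph; apply: eq_fmx => a b.
by rewrite natM dedge_invE andbA andbb; case: a.
Qed.

Let PB : P *m B = B.
Proof.
rewrite mulmx_graph; apply: eq_fmx => a b.
by rewrite natM /nonbacktracking andbA andbb.
Qed.

Let JT : J *m T = O'.
Proof.
rewrite mulmx_graph; apply: eq_fmx => a v.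
by rewrite natM dedge_invE andbA andbb.
Qed.

Let JO' : J *m O' = T.
Proof.
rewrite mulmx_graph; apply: eq_fmx => a v.
by rewrite natM dedge_invE andbA andbb.
Qed.

Let degree_sum v : \sum_(y : V) (e v y)%:R = q.+1%:R :> R.
Proof. by rewrite -(e_reg v) card_sum_bool. Qed.

Let OO' : O *m O' = q.+1%:R%:M.
Proof.
rewrite scalar_fmx mulmx_fmx; apply: eq_fmx => v w.
rewrite -(pair_big predT predT (fun x y => (is_dedge e (x, y) && (v == x))%:R *
   (is_dedge e (x, y) && (w == x))%:R : R)) /= (bigD1 v) //= [X in _ + X]big1.
  rewrite addr0 eqxx (eq_sym w); case: eqVneq => _; rewrite ?mulr1n ?mulr0n.
    rewrite -(degree_sum v); apply: eq_bigr => y _.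
    by rewrite natM !andbT andbb.
  by apply: big1 => y _; rewrite natM !andbF.
move=> x /negPf xv; apply: big1 => y _.
by rewrite natM (eq_sym v) xv andbF.
Qed.

Let trP : \tr P = q.+1%:R * #|V|%:R.
Proof.
rewrite mxtrace_fmx -(pair_big predT predT (fun x y =>
   (is_dedge e (x, y) && ((x, y) == (x, y)))%:R : R)) /=.
rewrite mulr_natr -sumr_const; apply: eq_bigr => x _.
by rewrite -(degree_sum x); apply: eq_bigr => y _; rewrite eqxx andbT.
Qed.

Let trA : \tr A = 0.
Proof. by rewrite mxtrace_fmx big1 // => x _; rewrite e_irr. Qed.

Let trAA : \tr (A ^+ 2) = q.+1%:R * #|V|%:R.
Proof.
rewrite expr2 [X in \tr X]mulmx_fmx mxtrace_fmx.
rewrite mulr_natr -sumr_const; apply: eq_bigr => x _.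
rewrite -(degree_sum x); apply: eq_bigr => y _.
by rewrite natM (e_sym y) andbb.
Qed.

Let X n := O *m (B ^+ n *m T).
Let Y n := O *m (B ^+ n *m O').

Let BS n : B ^+ n.+1 = B ^+ n *m (T *m O - J).
Proof. by rewrite exprSr BE. Qed.

(** Absorbing the last factor: O O' counts the q + 1 darts at a vertex, and
J O' = T removes one of them. *)
Let YS n : Y n.+1 = q%:R *: X n.
Proof.
rewrite /Y BS -mulmxA mulmxBl JO' -(mulmxA T) OO' mul_mx_scalar.
by rewrite -natr1 scalerDl scale1r addrK -scalemxAr -scalemxAr.
Qed.

Let X0 : X 0 = A.
Proof. by rewrite /X expr0 mul1mx OT. Qed.

Let XS n : X n.+1 = X n * A - Y n.
Proof.
rewrite /X BS -mulmxA mulmxBl JT -(mulmxA T) OT [B ^+ n *m _]mulmxBr.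
by rewrite [LHS]mulmxBr -/(Y n); congr (_ - _); rewrite !mulmxA.
Qed.

Let N n := \tr (B ^+ n).

(** Expanding the last factor B = T O - J leaves a trace over vertices and a
trace against J.  The latter is turned by cyclicity into J B (...), where J J is
the projection P: this removes two steps at once, just as stripping the first
and the last step of a closed walk with a tail does. *)
Let N_rec n : N n.+2 = \tr (X n.+1) - \tr (Y n) + \tr (P *m B ^+ n).
Proof.
have trJ : \tr (B ^+ n.+1 *m J) = \tr (Y n) - \tr (P *m B ^+ n).
  rewrite mxtrace_mulC exprS -mulmxE mulmxA BE mulmxBr mulmxA JT JJ mulmxBl.
  by rewrite raddfB /= -mulmxA mxtrace_mulC -mulmxA -BE.
rewrite /N BS mulmxBr raddfB /= trJ opprB addrA mulmxA mxtrace_mulC.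
by rewrite addrAC.
Qed.

Let N1 : N 1 = 0.
Proof.
rewrite /N expr1 mxtrace_fmx big1 // => -[x y] _.
rewrite /nonbacktracking /dedge_next /is_dedge /=.
by case: eqVneq => [->|_]; rewrite ?e_irr ?andbF.
Qed.

Let X1 : X 1 = A ^+ 2 - q.+1%:R%:M.
Proof. by rewrite XS X0 /Y expr0 mul1mx OO' expr2. Qed.

Let N2 : N 2 = 0.
Proof.
rewrite N_rec X1 /Y expr0 mul1mx OO' mulmx1 raddfB /= trAA trP !mxtrace_scalar.
by rewrite mulr_natr subrr sub0r addNr.
Qed.

Let N_step n : N n.+3 = N n.+1 + \tr (X n.+2) - q%:R * \tr (X n).
Proof.
rewrite N_rec YS mxtraceZ exprS -mulmxE mulmxA PB mulmxE -exprS.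
by rewrite -/(N n.+1) addrC addrA.
Qed.

Let X_rec n : X n.+2 = X n.+1 * A - q%:R *: X n.
Proof. by rewrite XS YS. Qed.

(* C n is the n-th rescaled Chebyshev polynomial (of the second kind) in A; it
   enters through its three-term recurrence and its initial values. *)
Variable C : nat -> 'M[R]_#|V|.
Hypothesis C0 : C 0 = 1.
Hypothesis C1 : C 1 = A.
Hypothesis C_rec : forall n, C n.+2 = C n.+1 * A - q%:R *: C n.

(** X n.+1 counts the non-backtracking walks of length n.+2 between vertices; it
satisfies the Chebyshev recurrence with modified initial values, because the
first step can be taken in q + 1 ways and every later one in q. *)
Let XC n : X n.+1 = C n.+2 - C n.
Proof.
suff [] : X n.+1 = C n.+2 - C n /\ X n.+2 = C n.+3 - C n.+1 by [].
elim: n => [|n [IH1 IH2]].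
  have e1 : X 1 = C 2 - C 0.
    rewrite X1 C_rec C1 C0 expr2 -natr1 raddfD /= opprD addrA.
    by rewrite -scalemx1.
  split=> //; rewrite X_rec e1 X0 (C_rec 1) (C_rec 0) C1 C0.
  by rewrite mulrBl mul1r addrAC.
split=> //; rewrite X_rec IH1 IH2 (C_rec n.+2).
by rewrite mulrBl scalerBr opprD addrACA -opprD -(C_rec n).
Qed.

(** This is the trace form of the Ihara-Bass formula: C n.+2 - q C n is the
Dickson polynomial D_n.+2 in A, and the last term stands for the factor
(1 - u^2)^(|E| - |V|) of the Ihara zeta function.  By [N_step] both sides change
in the same way when n grows by two, so only the lengths 2 and 3 need a
computation. *)
Lemma trace_nonbacktracking n :
  \tr (B ^+ n.+2) =
  \tr (C n.+2) - q%:R * \tr (C n) + (~~ odd n)%:R * ((q%:R - 1) * #|V|%:R).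
Proof.
rewrite -/(N n.+2).
suff [] : N n.+2 = \tr (C n.+2) - q%:R * \tr (C n)
      + (~~ odd n)%:R * ((q%:R - 1) * #|V|%:R)
  /\ N n.+3 = \tr (C n.+3) - q%:R * \tr (C n.+1)
      + (odd n)%:R * ((q%:R - 1) * #|V|%:R) by [].
elim: n => [|n [IH1 IH2]]; last first.
  split; rewrite /= ?negbK // N_step IH1 !XC !raddfB /=.
  by case: (odd n) => /=; ring.
split; last first.
  by rewrite N_step N1 XC X0 raddfB /= C1 trA; ring.
rewrite N2 C_rec C1 C0 -expr2 raddfB /= mxtraceZ trAA mxtrace1 -natr1.
by rewrite /=; ring.
Qed.
End Darts.

Section Chebyshev.
Variables (R : comNzRingType) (m : nat) (q : R) (A : 'M[R]_m).

Definition chebyshev_mx (n : nat) : 'M[R]_m :=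
  \sum_(k < n.+1) ((- q) ^+ k * 'C(n - k, k)%:R) *: A ^+ (n - k.*2).

Lemma chebyshev_mx0 : chebyshev_mx 0 = 1.
Proof. by rewrite /chebyshev_mx big_ord1 mul1r bin0 scale1r. Qed.

Lemma chebyshev_mx1 : chebyshev_mx 1 = A.
Proof.
by rewrite /chebyshev_mx 2!big_ord_recl big_ord0 /= mul1r mulr0 scale0r
           !addr0 scale1r.
Qed.

(** Pascal's rule on the binomials; where the exponent n - 2k is truncated the
coefficient vanishes. *)
Lemma chebyshev_mxS n :
  chebyshev_mx n.+2 = chebyshev_mx n.+1 * A - q *: chebyshev_mx n.
Proof.
rewrite /chebyshev_mx big_ord_recl [in RHS]big_ord_recl big_ord_recr /=.
rewrite /bump /= !add1n subnn bin0n mulr0 scale0r addr0 mulrDl.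
rewrite mulr_suml scaler_sumr.
rewrite -[in RHS]addrA -sumrN -big_split /= !expr0 !bin0 !mulr1 !scale1r.
congr (_ + _); first by rewrite -exprSr.
apply: eq_bigr => k _; rewrite !add1n.
have kn : (k <= n)%N by rewrite -ltnS.
rewrite [(n.+2 - _)%N]subSS subSn // binS natrD mulrDr scalerDl.
congr (_ + _); last by rewrite doubleS scalerA -scaleNr exprS !mulNr mulrA.
rewrite doubleS subSS; have [lt_nk|le_kn] := ltnP (n - k) k.+1.
  by rewrite bin_small // mulr0 !scale0r mul0r.
rewrite -[RHS]scalemxAl mulmxE -exprSr; congr (_ *: A ^+ _); lia.
Qed.
End Chebyshev.

(** The coefficient of X ^ (n - 2k) in the Dickson polynomial D_n, in the form
n / (n - k) * 'C(n - k, k) * (- q) ^ k written with factorials. *)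
Definition dickson_coef (F : fieldType) (q : F) (n k : nat) : F :=
  (- q) ^+ k * (n%:R * (n - k).-1`!%:R / (k`!%:R * (n - k.*2)`!%:R)).

Lemma fact_neq0 (F : numDomainType) n : n`!%:R != 0 :> F.
Proof. by rewrite pnatr_eq0 -lt0n fact_gt0. Qed.

Lemma dickson_binomial (F : numFieldType) n k : (k.*2 <= n)%N ->
  'C(n.+1 - k, k.+1)%:R + 'C(n - k, k)%:R =
  n.+2%:R * (n - k)`!%:R / (k.+1`!%:R * (n - k.*2)`!%:R) :> F.
Proof.
move=> le_kn; apply: (canRL (mulfK _)); first by rewrite mulf_neq0 ?fact_neq0.
rewrite -natrD -!natrM; congr (_%:R).
have le_kn' : (k <= n - k)%N by lia.
have e2 : (n - k - k = n - k.*2)%N by lia.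
have e1 : (n.+1 - k - k.+1 = n - k.*2)%N by lia.
have lt_kn : (k < n.+1 - k)%N by lia.
rewrite mulnDl -{1}e1 bin_fact // factS -!mulnA mulnCA -e2 bin_fact //.
rewrite subSn ?(leq_trans le_kn') ?leq_subr // factS -mulnDl.
by congr (_ * _)%N; lia.
Qed.

(** This is D_n+2 = C_n+2 - q C_n for the Dickson and the Chebyshev polynomials,
seen through an arbitrary linear functional with values t m on the powers X ^ m. *)
Lemma dickson_sum (F : numFieldType) (q : F) (t : nat -> F) n :
  \sum_(k < n.+3) ((- q) ^+ k * 'C(n.+2 - k, k)%:R) * t (n.+2 - k.*2)%N
  - q * \sum_(k < n.+1) ((- q) ^+ k * 'C(n - k, k)%:R) * t (n - k.*2)%N
  = \sum_(k < n.+3 | (k.*2 <= n.+2)%N)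
      dickson_coef q n.+2 k * t (n.+2 - k.*2)%N.
Proof.
rewrite [RHS]big_mkcond /= big_ord_recl [in RHS]big_ord_recl big_ord_recr.
rewrite [in RHS]big_ord_recr /= /bump /= !add1n subnn bin0n mulr0 mul0r addr0.
rewrite ifN ?addr0; last by lia.
rewrite -addrA; congr (_ + _).
  rewrite /dickson_coef /= expr0 bin0 !mul1r -natrM -factS.
  by rewrite divff ?fact_neq0 ?mul1r.
rewrite mulr_sumr -sumrN -big_split; apply: eq_bigr => k _ /=.
rewrite /bump /= !add1n !doubleS !subSS.
have kn : (k <= n)%N by rewrite -ltnS.
rewrite 2!ltnS; case: leqP => [le_kn|lt_nk]; last first.
  by rewrite !bin_small ?mulr0 ?mul0r ?mulr0 ?subrr //; lia.
rewrite /dickson_coef doubleS !subSS subSn // [_.+1.-1]/= -subSn //.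
rewrite -dickson_binomial // exprS; ring.
Qed.

(** In a cycle every entry is the source of some consecutive pair, so a
condition on both ends of each pair is a condition on all entries. *)
Lemma cycle_andl (T : Type) (D : pred T) (r : rel T) (s : seq T) :
  path.cycle (fun a b => [&& D a, D b & r a b]) s = all D s && path.cycle r s.
Proof.
have pathE x y s' : path (fun a b => [&& D a, D b & r a b]) x (rcons s' y) =
    [&& D x, all D s', D y & path r x (rcons s' y)].
  elim: s' x => [|z s' IHs] x /=; first by rewrite !andbT.
  rewrite IHs; case: (D x) => //=; case: (D z) => //=; case: (all D s') => //=;
  by rewrite ?andbF //; case: (D y); rewrite /= ?andbF.
by case: s => //= x s; rewrite pathE; case: (D x); case: (all D s).
Qed.

Lemma reduced_cycleE (V : finType) (e : rel V) n (c : n.-tuple (V * V)) :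
  is_reduced_cycle e c = path.cycle (nonbacktracking e) c.
Proof.
rewrite /is_reduced_cycle (cycle_andl (is_dedge e)
  [rel a b | dedge_next a b && no_backtrack a b]).
by rewrite (cycle_relI (@dedge_next V)).
Qed.

Theorem num_reduced_cycles_regular (F : numFieldType) (V : finType) (e : rel V)
    (q n : nat) :
  symmetric e -> irreflexive e -> (forall x, #|[set y | e x y]| = q.+1) ->
  (num_reduced_cycles e n.+2)%:R =
  \sum_(k < n.+3 | (k.*2 <= n.+2)%N)
    dickson_coef q%:R n.+2 k * \tr (relmx F e ^+ (n.+2 - k.*2))
  + (~~ odd n)%:R * ((q%:R - 1) * #|V|%:R).
Proof.
move=> e_sym e_irr e_reg.
have -> : (num_reduced_cycles e n.+2)%:R =
    \tr (relmx F (nonbacktracking e) ^+ n.+2).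
  rewrite mxtrace_relmxX; congr (_%:R); apply: eq_card => c.
  by rewrite !inE reduced_cycleE.
rewrite (trace_nonbacktracking e_sym e_irr e_reg
  (C := chebyshev_mx q%:R (relmx F e)));
  [|exact: chebyshev_mx0|exact: chebyshev_mx1|exact: chebyshev_mxS].
rewrite -(dickson_sum q%:R (fun m => \tr (relmx F e ^+ m))).
rewrite /chebyshev_mx !raddf_sum /=.
by congr (_ - _ * _ + _); apply: eq_bigr => k _; rewrite mxtraceZ.
Qed.

(** * Counting walks on the lattice Z^d *)

Section LabelledWalks.
Variables (R : comNzRingType) (T I : finType) (act : T -> I -> T).

Lemma label_mxX n :
  fmx (fun x y => (#|[set i | act x i == y]|)%:R : R) ^+ n =
  fmx (fun x y => (#|[set t : n.-tuple I | foldl act x t == y]|)%:R).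
Proof.
elim: n => [|n IHn].
  rewrite expr0 [LHS](scalar_fmx T 1); apply: eq_fmx => x y.
  rewrite card_sum_bool (bigD1 [tuple]) //= big1 ?addr0 // => t.
  by rewrite tuple0.
rewrite exprS IHn [LHS]mulmx_fmx; apply: eq_fmx => x y.
under eq_bigr do rewrite card_sum_bool mulr_suml.
rewrite exchange_big card_sum_bool sum_tupleS /=; apply: eq_bigr => i _.
rewrite (bigD1 (act x i)) //= big1 ?addr0 => [|z /negPf].
  by rewrite eqxx mul1r card_sum_bool.
by rewrite eq_sym => ->; rewrite mul0r.
Qed.
End LabelledWalks.

Section TupleContent.
Variable I : finType.

(** The multinomial coefficient: by induction on the length, removing the first
entry i lowers the content at i by one, and the factorials then contribute the
factor c i, whose sum over i is m. *)
Lemma card_tuple_content m (c : I -> nat) : (\sum_i c i)%N = m ->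
  (#|[set t : m.-tuple I | [forall i, count_mem i t == c i]]|
   * \prod_i (c i)`!)%N = m`!.
Proof.
have cardE n (P : pred (n.-tuple I)) : #|[set t | P t]| = (\sum_t P t)%N.
  exact: card_set_sum.
elim: m c => [|m IHm] c sum_c.
  have c0 i : c i = 0%N.
    by apply/eqP; move/eqP: sum_c; rewrite sum_nat_eq0 => /forallP/(_ i).
  rewrite cardE (bigD1 [tuple]) //= big1 ?addn0 => [|t]; last by rewrite tuple0.
  have -> : [forall i, 0 == c i]%N by apply/forallP => i; rewrite c0.
  by rewrite big1 // => i _; rewrite c0.
have sumS (F : m.+1.-tuple I -> nat) :
  (\sum_t F t = \sum_i \sum_(t : m.-tuple I) F [tuple of i :: t])%N.
  exact: sum_tupleS.
rewrite cardE sumS factS.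
transitivity ((\sum_i c i) * m`!)%N; last by rewrite sum_c.
rewrite !big_distrl /=; apply: eq_bigr => i _.
have [ci0|ci_gt0] := posnP (c i).
  rewrite ci0 mul0n big1 ?mul0n // => t _.
  apply/eqP; rewrite eqb0; apply/negP => /forallP/(_ i).
  by rewrite /= eqxx ci0.
pose c' j := (c j - (j == i))%N.
have sum_c' : (\sum_j c' j)%N = m.
  rewrite (bigD1 i) //= /c' eqxx; move: sum_c; rewrite (bigD1 i) //= => sum_c.
  suff : (\sum_(j | j != i) (c j - (j == i)) = \sum_(j | j != i) c j)%N by lia.
  by apply: eq_bigr => j /negPf ->; rewrite subn0.
rewrite -(IHm c' sum_c') mulnCA; congr (_ * _)%N.
  rewrite cardE; apply: eq_bigr => t _; congr (nat_of_bool _).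
  apply: eq_forallb => j /=; rewrite /c' (eq_sym j).
  by case: (eqVneq i j) => [<-|_] /=; rewrite ?subn0 //; lia.
rewrite (bigD1 i) //= [in RHS](bigD1 i) //= mulnA /c' eqxx subn1.
rewrite -{1}(prednK ci_gt0) factS prednK //; congr (_ * _)%N.
by apply: eq_bigr => j /negPf ->; rewrite subn0.
Qed.
End TupleContent.

Section Displacement.
Variable d : nat.

Definition displacement (t : seq ('I_d * bool)) (j : 'I_d) : int :=
  (count_mem (j, true) t)%:Z - (count_mem (j, false) t)%:Z.

Definition l1norm (w : 'I_d -> int) : nat := (\sum_j `|w j|)%N.

Definition num_walks (m : nat) (w : 'I_d -> int) : nat :=
  #|[set t : m.-tuple ('I_d * bool) | [forall j, displacement t j == w j]]|.

Lemma sum_count_mem_size (I : finType) (s : seq I) :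
  (\sum_i count_mem i s)%N = size s.
Proof.
elim: s => [|x s IHs] /=; first by rewrite big1.
rewrite big_split /= IHs (bigD1 x) //= eqxx big1 ?addn0 ?add1n // => i.
by rewrite eq_sym => /negPf ->.
Qed.

(* A walk to w with v j cancelling pairs in direction j takes v j backward
   steps and v j + w j forward ones when w j >= 0; the signs are swapped
   otherwise. *)
Let content (w : 'I_d -> int) (v : 'I_d -> nat) (i : 'I_d * bool) : nat :=
  (v i.1 + if i.2 == (0 <= w i.1)%R then `|w i.1| else 0)%N.

Let contentE (w : 'I_d -> int) (v : 'I_d -> nat) (t : seq ('I_d * bool)) :
  (forall i, count_mem i t = content w v i) <->
  (forall j, displacement t j = w j /\
     minn (count_mem (j, true) t) (count_mem (j, false) t) = v j).
Proof.
rewrite /displacement /content; split=> [ct j|dt [j b]].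
  by rewrite !ct /=; case: (lerP 0 (w j)) => /=; split; lia.
by have [] := dt j; case: b; case: (lerP 0 (w j)) => /=; lia.
Qed.

Let sum_content (w : 'I_d -> int) (v : 'I_d -> nat) :
  (\sum_i content w v i = l1norm w + (\sum_j v j).*2)%N.
Proof.
rewrite -(pair_bigA _ (fun j b => content w v (j, b))) /= -mul2n big_distrr.
rewrite -big_split; apply: eq_bigr => j _.
by rewrite big_bool /content /=; case: (lerP 0 (w j)) => /=; lia.
Qed.

Let prod_content (w : 'I_d -> int) (v : 'I_d -> nat) :
  (\prod_i (content w v i)`! = \prod_j ((v j)`! * (v j + `|w j|)`!))%N.
Proof.
rewrite -(pair_bigA _ (fun j b => (content w v (j, b))`!)) /=.
apply: eq_bigr => j _; rewrite big_bool /content /=.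
by case: (lerP 0 (w j)) => /=; rewrite addn0 // mulnC.
Qed.

(** Classify the walks by the number of cancelling pairs of steps in each
direction, the smaller of the two step counts: together with w it determines the
number of steps of each kind.  The bound N on these numbers is free so that
walks of several lengths can share one index set. *)
Lemma num_walksE (F : numFieldType) (N m : nat) (w : 'I_d -> int) :
  (m <= l1norm w + N.*2)%N ->
  (num_walks m w)%:R =
  \sum_(v : {ffun 'I_d -> 'I_N.+1} | (l1norm w + (\sum_j v j).*2 == m)%N)
     m`!%:R / \prod_j ((v j)`!%:R * (v j + `|w j|)`!%:R) :> F.
Proof.
move=> le_mN; rewrite /num_walks card_set_sum.
pose P (v : {ffun 'I_d -> 'I_N.+1}) := (l1norm w + (\sum_j v j).*2 == m)%N.
have split_t (t : m.-tuple ('I_d * bool)) :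
  ([forall j, displacement t j == w j] =
   \sum_(v : {ffun 'I_d -> 'I_N.+1} | P v)
     [forall i, count_mem i t == content w (fun j => v j) i] :> nat)%N.
  case: forallP => [dt|dt]; last first.
    rewrite big1 // => v _; apply/eqP; rewrite eqb0.
    apply/negP => /'forall_eqP ct.
    by case: dt => j; have /contentE/(_ j)[/eqP] := ct.
  pose u j := minn (count_mem (j, true) t) (count_mem (j, false) t).
  have ct : forall i, count_mem i t = content w u i.
    by apply/contentE => j; split=> //; apply/eqP.
  have sum_u : (l1norm w + (\sum_j u j).*2 = m)%N.
    rewrite -sum_content -[RHS](size_tuple t) -sum_count_mem_size.
    by apply: eq_bigr => i _; rewrite ct.
  have u_le j : (u j <= N)%N.
    have : (u j <= \sum_j u j)%N by rewrite (bigD1 j) //= leq_addr.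
    lia.
  pose v0 : {ffun 'I_d -> 'I_N.+1} := [ffun j => inord (u j)].
  have v0E j : v0 j = u j :> nat by rewrite ffunE inordK // ltnS.
  have Pv0 : P v0 by rewrite /P; under eq_bigr do rewrite v0E; rewrite sum_u.
  rewrite (bigD1 v0) //= big1 ?addn0.
    apply/esym/eqP; rewrite eqb1; apply/'forall_eqP => i.
    by rewrite ct /content v0E.
  move=> v /andP[_ /eqP v_neq]; apply/eqP; rewrite eqb0.
  apply/negP => /'forall_eqP cv.
  apply: v_neq; apply/ffunP => j; apply: val_inj; rewrite /= v0E.
  by have /contentE/(_ j)[_ <-] := cv.
under eq_bigr do rewrite split_t.
rewrite exchange_big natr_sum; apply: eq_bigr => v /eqP Pv.
rewrite -card_set_sum; apply: (canRL (mulfK _)).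
  by apply/prodf_neq0 => j _; rewrite mulf_neq0 ?fact_neq0.
rewrite -(card_tuple_content (c := content w (fun j => v j))); last first.
  by rewrite sum_content.
rewrite natrM prod_content natr_prod; congr (_ * _).
by apply: eq_bigr => j _; rewrite natrM.
Qed.

(** A finite index set for sums over Z^d: walks of length at most n only reach
points with coordinates in [-n, n]. *)
Definition int_box (n : nat) : seq {ffun 'I_d -> int} :=
  undup [seq [ffun j => (v j)%:Z - n%:Z] | v : {ffun 'I_d -> 'I_(n.*2).+1}].

Lemma mem_int_box n (y : {ffun 'I_d -> int}) :
  (forall j, `|y j| <= n)%N -> y \in int_box n.
Proof.
move=> y_le; rewrite mem_undup; apply/codomP.
exists [ffun j => inord (absz (y j + n%:Z))].
apply/ffunP => j; rewrite !ffunE inordK.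
  by move: (y j) (y_le j) => z; lia.
by move: (y j) (y_le j) => z; lia.
Qed.

Lemma int_box_uniq n : uniq (int_box n).
Proof. exact: undup_uniq. Qed.

Lemma l1norm_displacement (t : seq ('I_d * bool)) :
  (l1norm (displacement t) <= size t)%N.
Proof.
rewrite -sum_count_mem_size -(pair_bigA _ (fun j b => count_mem (j, b) t)) /=.
apply: leq_sum => j _; rewrite big_bool /displacement /=.
by move: (count _ t) (count _ t) => a b; lia.
Qed.

End Displacement.

(** * Closed walks on the torus *)

Lemma intr_Zp_eq0 (m : nat) (z : int) : (1 < m)%N ->
  (z%:~R == 0 :> 'Z_m) = (m %| `|z|)%N.
Proof.
move=> m_gt1; have natE k : (k%:R == 0 :> 'Z_m) = (m %| k)%N.
  by rewrite -val_eqE /= val_Zp_nat.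
by case: z => k; rewrite ?NegzE ?mulrNz ?oppr_eq0 natE.
Qed.

Section Torus.
Variables (d : nat) (M : 'I_d -> nat).
Hypothesis M_ge3 : forall j, (3 <= M j)%N.

(** Labelling the generators by a direction and a sign lets a walk on the torus
be read as a walk on Z^d. *)
Definition step_gen (i : 'I_d * bool) : torus M :=
  if i.2 then torus_delta M i.1 else (torus_delta M i.1)^-1%g.

Let step (x : torus M) (i : 'I_d * bool) : torus M := (x * step_gen i)%g.

Lemma torus_deltaE i j : torus_delta M i j = (i == j)%:R :> 'Z_(M j).
Proof.
have [<-|ij] := eqVneq i j; first exact: dfung1_id.
exact: dfung1_dflt.
Qed.

Lemma step_genE i j :
  step_gen i j = (i == (j, true))%:R - (i == (j, false))%:R :> 'Z_(M j).
Proof.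
case: i => k b; rewrite /step_gen !xpair_eqE /=.
case: b; first by rewrite [LHS]torus_deltaE andbT andbF subr0.
transitivity (- (torus_delta M k j : 'Z_(M j))); first by rewrite ffunE.
by rewrite torus_deltaE andbT andbF sub0r.
Qed.

Lemma foldl_stepE (x : torus M) t j :
  foldl step x t j = (x j : 'Z_(M j)) + (displacement t j)%:~R :> 'Z_(M j).
Proof.
elim: t x => [|i t IHt] x /=; first by rewrite /displacement subrr mulr0z addr0.
rewrite IHt /step ffunE.
have -> : ((x j * step_gen i j)%g = (x j : 'Z_(M j)) + step_gen i j) by [].
rewrite step_genE -addrA; congr (_ + _).
have -> : displacement (i :: t) j =
    (i == (j, true))%:Z - (i == (j, false))%:Z + displacement t j.
  by rewrite /displacement /= !PoszD; ring.
by rewrite intrD intrB.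
Qed.

(** This is where sides of length at least 3 matter: on a side of length 2 a
generator is its own inverse and two labels would give the same edge. *)
Lemma step_gen_inj : injective step_gen.
Proof.
have one_neq0 j : (1 : 'Z_(M j)) != 0 by exact: oner_neq0.
have one_neqN1 j : (1 : 'Z_(M j)) != -1.
  rewrite -subr_eq0 opprK; have M_gt1 : (1 < M j)%N by have := M_ge3 j; lia.
  have := intr_Zp_eq0 2 M_gt1; rewrite rmorphD /= => ->.
  by apply/negP => /dvdn_leq -/(_ isT); have := M_ge3 j; lia.
move=> [k b] [k' b'] eq_gen.
have genE j :
    (((k, b) == (j, true))%:R - ((k, b) == (j, false))%:R : 'Z_(M j)) =
    ((k', b') == (j, true))%:R - ((k', b') == (j, false))%:R.
  by rewrite -!step_genE eq_gen.
have := genE k; rewrite !xpair_eqE eqxx /=.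
have [<-|_] := eqVneq k' k; last first.
  case: b {eq_gen genE} => /= /eqP; rewrite ?subr0 ?sub0r ?oppr_eq0.
    by rewrite (negPf (one_neq0 k)).
  by rewrite (negPf (one_neq0 k)).
case: b b' {eq_gen genE} => -[] //= /eqP; rewrite ?subr0 ?sub0r ?(eq_sym (- 1)).
  by rewrite (negPf (one_neqN1 k')).
by rewrite (negPf (one_neqN1 k')).
Qed.

Lemma torus_relE x y :
  discrete_torus M x y = #|[set i | step x i == y]| :> nat.
Proof.
rewrite card_set_sum /discrete_torus /cayley_rel.
have stepE i : (step x i == y) = (step_gen i == (x^-1 * y)%g).
  by rewrite /step -(inj_eq (mulgI x^-1%g)) mulKg.
under eq_bigr do rewrite stepE; set g := (x^-1 * y)%g.
have gensP : reflect (exists i, step_gen i = g) (g \in torus_gens M).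
  apply: (iffP setUP) => [[]/imsetP[j _ ->]|[[j [] <-]]].
  - by exists (j, true).
  - by exists (j, false).
  - by left; apply/imsetP; exists j.
  - by right; apply/imsetP; exists j.
case: gensP => [[i <-]|no_i].
  rewrite (bigD1 i) //= eqxx big1 // => k /negPf.
  by rewrite (inj_eq step_gen_inj) => ->.
rewrite big1 // => i _; apply/eqP; rewrite eqb0; apply/eqP => gi.
by case: no_i; exists i.
Qed.

Lemma card_torus : #|torus M| = (\prod_j M j)%N.
Proof.
rewrite card_dep_ffun foldrE big_map big_enum /=; apply: eq_bigr => j _.
by rewrite card_ord Zp_cast //; have := M_ge3 j; lia.
Qed.

(** The displacement does not depend on the base point, whence the factor
counting the vertices. *)
Lemma torus_closed_walks (R : comNzRingType) m :
  \tr (relmx R (discrete_torus M) ^+ m) =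
  (\prod_j M j)%:R *
  (#|[set t : m.-tuple ('I_d * bool) |
      [forall j, M j %| `|displacement t j|]%N]|)%:R.
Proof.
have -> : relmx R (discrete_torus M) =
    fmx (fun x y => (#|[set i | step x i == y]|)%:R).
  by apply: eq_fmx => x y; rewrite torus_relE.
rewrite label_mxX mxtrace_fmx -card_torus mulr_natl -sumr_const.
apply: eq_bigr => x _; congr (_%:R); apply: eq_card => t; rewrite !inE.
apply/eqP/forallP => [xt j|t0].
  rewrite -intr_Zp_eq0; last by have := M_ge3 j; lia.
  have := foldl_stepE x t j; rewrite xt => /esym/eqP.
  by rewrite -subr_eq0 addrC addKr.
apply/ffunP => j; rewrite [LHS]foldl_stepE.
have := t0 j; rewrite -intr_Zp_eq0; last by have := M_ge3 j; lia.
by move=> /eqP ->; rewrite addr0.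
Qed.

Lemma torus_sym : symmetric (discrete_torus M).
Proof.
have gensV g : g \in torus_gens M -> g^-1%g \in torus_gens M.
  case/setUP => /imsetP[j _ ->]; apply/setUP; [right|left];
    apply/imsetP; exists j => //.
  by rewrite invgK.
move=> x y; rewrite /discrete_torus /cayley_rel.
by apply/idP/idP => /gensV; rewrite invMg invgK.
Qed.

Lemma torus_irr : irreflexive (discrete_torus M).
Proof.
move=> x; suff : nat_of_bool (discrete_torus M x x) = 0%N.
  by case: (discrete_torus M x x).
rewrite torus_relE; apply/eqP; rewrite cards_eq0; apply/eqP/setP => -[j b].
rewrite !inE /step; apply/eqP => /(canRL (mulKg x)); rewrite mulVg => gen1.
have := step_genE (j, b) j; rewrite gen1 ffunE !xpair_eqE eqxx /=.
have /negPf one_neq0 : (1 : 'Z_(M j)) != 0 by exact: oner_neq0.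
by case: b {gen1} => /esym/eqP; rewrite ?subr0 ?sub0r ?oppr_eq0 one_neq0.
Qed.

Lemma torus_reg x : #|[set y | discrete_torus M x y]| = d.*2.
Proof.
rewrite card_set_sum; under eq_bigr do rewrite torus_relE card_set_sum.
rewrite exchange_big /= (eq_bigr (fun=> 1%N)) => [|i _].
  by rewrite sum1_card card_prod card_ord card_bool muln2.
rewrite (bigD1 (step x i)) //= eqxx big1 // => y /negPf.
by rewrite eq_sym => ->.
Qed.

(** Each displacement whose coordinates are divisible by the M j is reached for
exactly one quotient y. *)
Lemma torus_closed_walks_int (R : comNzRingType) n m : (m <= n)%N ->
  \tr (relmx R (discrete_torus M) ^+ m) =
  (\prod_j M j)%:R *
  \sum_(y <- int_box d n) (num_walks m (fun j => (M j)%:Z * y j))%:R.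
Proof.
move=> le_mn; rewrite torus_closed_walks -natr_sum card_set_sum.
congr (_ * _%:R).
under [RHS]eq_bigr do rewrite /num_walks card_set_sum.
rewrite exchange_big /=; apply: eq_bigr => t _.
have M_gt0 j : (0 < M j)%N by have := M_ge3 j; lia.
case: forallP => [dt|no_dt]; last first.
  rewrite big1 // => y _; apply/eqP; rewrite eqb0.
  apply/negP => /'forall_eqP ty.
  by case: no_dt => j; rewrite ty abszM dvdn_mulr.
pose y0 : {ffun 'I_d -> int} := [ffun j => (displacement t j %/ (M j)%:Z)%Z].
have y0E j : (M j)%:Z * y0 j = displacement t j.
  by rewrite ffunE mulrC divzK //; exact: dt.
rewrite (bigD1_seq y0) ?int_box_uniq //=; last first.
  apply: mem_int_box => j; apply: leq_trans le_mn.
  apply: (@leq_trans `|displacement t j|%N).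
    by rewrite -y0E abszM leq_pmull //; exact: M_gt0.
  have := l1norm_displacement t; rewrite size_tuple; apply: leq_trans.
  by rewrite /l1norm (bigD1 j) //= leq_addr.
rewrite big1 => [|y y_neq].
  rewrite addn0; apply/esym/eqP; rewrite eqb1.
  by apply/'forall_eqP => j; rewrite y0E.
apply/eqP; rewrite eqb0; apply/negP => /'forall_eqP ty; case/eqP: y_neq.
apply/ffunP => j; apply: (mulfI (x := (M j)%:Z)).
  by have := M_gt0 j; lia.
by rewrite y0E ty.
Qed.
End Torus.

(** * From Dickson coefficients to the generalized Jacobi polynomial *)

Section Hypergeometric.
Variable F : numFieldType.

Lemma pochhammer_nat a k : pochhammer (a%:R + 1) k * a`!%:R = (a + k)`!%:R :> F.
Proof.
elim: k => [|k IHk]; first by rewrite /pochhammer big_ord0 mul1r addn0.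
rewrite /pochhammer big_ord_recr /= mulrAC -/(pochhammer _ k) IHk addnS factS.
by rewrite natrM mulrC -addrA -natr1 natrD; congr (_ * _); ring.
Qed.

Lemma pochhammer_opp n k : (k <= n)%N ->
  pochhammer (- n%:R) k * (n - k)`!%:R = (-1) ^+ k * n`!%:R :> F.
Proof.
elim: k => [|k IHk] lt_kn; first by rewrite /pochhammer big_ord0 subn0 expr0.
rewrite exprS -mulrA -IHk ?(ltnW lt_kn) // /pochhammer big_ord_recr /=.
rewrite -/(pochhammer _ k) -[in RHS](subnSK lt_kn) factS (subnSK lt_kn).
rewrite natrM natrB ?(ltnW lt_kn) //.
ring.
Qed.

(** Every Pochhammer symbol is a quotient of factorials: (h+1)_K h! = (h+K)!,
and so on.  The factor (h+K-1)! cancels between n/(n+h) (h+1)_K h! and (K+h)_s,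
while the signs of (-K)_s and of (-q)^K leave (-q)^(K-s). *)
Lemma jacobi_term (q : F) (d n h K s : nat) (w v : 'I_d -> nat) :
  q != 0 -> (0 < n)%N -> n = (h + K.*2)%N -> (s <= K)%N ->
  \sum_j v j = s -> \sum_j w j = h ->
  dickson_coef q n (K - s) *
    ((h + s.*2)`!%:R / \prod_j ((v j)`!%:R * (v j + w j)`!%:R)) =
  2 * n%:R * (- q) ^+ K / (n + h)%:R * multinomial F h w *
  (pochhammer (h%:R + 1) K / K`!%:R *
   lauricellaC_term (- K%:R) (K%:R + h%:R - 1 + 1) (fun j => (w j)%:R + 1)
     (fun=> q^-1) v).
Proof.
move=> q_neq0 n_gt0 nE le_sK sum_v sum_w.
have hK_gt0 : (0 < h + K)%N by lia.
rewrite /lauricellaC_term /multinomial sum_v /dickson_coef.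
have -> : (n - (K - s)).-1 = ((h + K).-1 + s)%N by lia.
have -> : (n - (K - s).*2 = h + s.*2)%N by lia.
have -> : (n + h)%:R = 2 * (h + K)%:R :> F.
  by rewrite -natrM; congr (_%:R); lia.
have -> : K%:R + h%:R - 1 + 1 = (h + K).-1%:R + 1 :> F.
  by rewrite natr1 prednK // natrD; ring.
have e1 := pochhammer_nat h K; have e2 := pochhammer_nat (h + K).-1 s.
have e3 := pochhammer_opp le_sK.
rewrite -[in (h + K)`!](prednK hK_gt0) factS natrM (prednK hK_gt0) in e1.
move/(canRL (mulfK (fact_neq0 _ _))) : e1 => ->.
move/(canRL (mulfK (fact_neq0 _ _))) : e3 => ->.
rewrite -e2.
pose Pv := \prod_j (v j)`!%:R : F; pose Pw := \prod_j (w j)`!%:R : F.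
pose Pvw := \prod_j (v j + w j)`!%:R : F.
have -> : \prod_j ((v j)`!%:R * (v j + w j)`!%:R) = Pv * Pvw.
  by rewrite big_split.
have -> : \prod_j pochhammer ((w j)%:R + 1) (v j) = Pvw / Pw.
  rewrite -prodf_div; apply: eq_bigr => j _.
  by apply/(canRL (mulfK (fact_neq0 _ _))); rewrite pochhammer_nat addnC.
have -> : \prod_j (q^-1 ^+ v j / (v j)`!%:R) = q^-1 ^+ s / Pv.
  by rewrite prodf_div -expr_sum sum_v.
rewrite -/Pw.
have Pv_neq0 : Pv != 0 by apply/prodf_neq0 => j _; rewrite fact_neq0.
have Pw_neq0 : Pw != 0 by apply/prodf_neq0 => j _; rewrite fact_neq0.
have Pvw_neq0 : Pvw != 0 by apply/prodf_neq0 => j _; rewrite fact_neq0.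
have Q_neq0 : q ^+ s != 0 by rewrite expf_neq0.
have hK_neq0 : (h + K)%:R != 0 :> F by rewrite pnatr_eq0 -lt0n.
have -> : (- q) ^+ K = (- q) ^+ (K - s) * ((-1) ^+ s * q ^+ s).
  by rewrite -exprNn -exprD subnK.
(* The sign (-1)^s occurs twice on the right, so the two sides agree as rational
   functions only after multiplying the left one by its square. *)
have sign2 : (-1) ^+ s * (-1) ^+ s = 1 :> F by rewrite -expr2 sqrr_sign.
rewrite exprVn.
have := (fact_neq0 F h, fact_neq0 F K, fact_neq0 F (K - s),
         fact_neq0 F (h + s.*2)).
move: (h`!%:R : F) (K`!%:R : F) ((K - s)`!%:R : F) ((h + s.*2)`!%:R : F).
move=> fh fK fKs fhs [[[fh0 fK0] fKs0] fhs0].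
clear e2; move: ((- q) ^+ (K - s)) (pochhammer _ s) => a p.
move: (((h + K).-1)`!%:R : F) => g.
move: ((-1) ^+ s) sign2 (q ^+ s) Q_neq0 => e sign2 Q Q_neq0.
transitivity
  (e * e * (a * (n%:R * (p * g) / (fKs * fhs)) * (fhs / (Pv * Pvw)))).
  by rewrite sign2 mul1r.
move: ((h + K)%:R : F) hK_neq0 => hK hK_neq0.
by field; do !(apply/andP; split=> //).
Qed.

(** What a lattice point with absolute coordinates w and l1 norm h contributes:
[torus_X] without its Kronecker delta, in terms of q = 2d - 1. *)
Definition walk_weight (q : F) (d n h : nat) (w : 'I_d -> nat) : F :=
  2 * n%:R * (- q) ^+ (n - h)./2 / (n + h)%:R * multinomial F h w *
  gen_jacobi (n - h)./2 (fun j => (w j)%:R) (-1) ((q - 2) / q).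

(** A walk to w spends its surplus steps in cancelling pairs, so its length
exceeds the norm of w by an even number. *)
Lemma num_walks_eq0 d m (w : 'I_d -> int) :
  ~~ ((l1norm w <= m)%N && (l1norm w == m %[mod 2])) -> num_walks m w = 0%N.
Proof.
move=> wm; apply/eqP; rewrite -(pnatr_eq0 F) (num_walksE F (N := m)); last lia.
rewrite big_pred0 // => v; apply/negP => /eqP eq_m; case/negP: wm.
by rewrite -eq_m leq_addr -muln2 addnC modnMDl eqxx.
Qed.

(** With K = (n - h) / 2, walks of length n - 2k to w have K - k cancelling
pairs.  Exchanging the sums, every v with |v| <= K meets the single index
k = K - |v|. *)
Lemma sum_dickson_walks (q : F) (d n : nat) (w : 'I_d -> int) :
  q != 0 -> (0 < n)%N ->
  \sum_(k < n.+1 | (k.*2 <= n)%N)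
     dickson_coef q n k * (num_walks (n - k.*2) w)%:R =
  if (l1norm w <= n)%N && (l1norm w == n %[mod 2])
  then walk_weight q n (l1norm w) (fun j => `|w j|%N) else 0.
Proof.
move=> q_neq0 n_gt0; case: ifPn => [/andP[le_wn /eqP mod_wn]|wn]; last first.
  apply: big1 => k le_kn; rewrite num_walks_eq0 ?mulr0 //.
  apply: contra wn => /andP[le_w /eqP mod_w]; apply/andP; split; first by lia.
  apply/eqP; rewrite mod_w; move: (nat_of_ord k) le_kn => i le_in.
  by rewrite -[in RHS](subnK le_in) -muln2 addnC modnMDl.
set h := l1norm w in le_wn mod_wn *; pose K := (n - h)./2.
have nE : n = (h + K.*2)%N by rewrite /K; lia.
rewrite /walk_weight -/K /gen_jacobi /lauricellaC_upto.
have -> : \sum_j (`|w j|%N)%:R = h%:R :> F by rewrite -natr_sum.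
have -> : (1 - (q - 2) / q) / 2 = q^-1 by field.
rewrite !mulr_sumr.
under eq_bigr => k le_kn.
  rewrite (num_walksE F (N := K)); last by rewrite -/h; lia.
  rewrite mulr_sumr -/h.
over.
rewrite (exchange_big_dep
    (fun v : {ffun 'I_d -> 'I_K.+1} => (\sum_j v j <= K)%N)) /=;
  last by move=> k v le_kn /eqP; lia.
apply: eq_bigr => v le_vK; set s := (\sum_j v j)%N in le_vK *.
have lt_Ks : (K - s < n.+1)%N by lia.
rewrite (big_pred1 (Ordinal lt_Ks)) => [|k]; last first.
  by rewrite /= -val_eqE /=; lia.
rewrite /= -(jacobi_term (s := s) (h := h) (n := n)) //.
by congr (_ * (_ `!%:R / _)); lia.
Qed.
End Hypergeometric.

(** * Grouping lattice points by their sorted absolute values *)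

Lemma nth_codom_ord d (z : 'I_d -> nat) (j : 'I_d) :
  nth 0%N [seq z i | i : 'I_d] j = z j.
Proof. by rewrite (nth_map j) ?size_enum_ord ?nth_ord_enum. Qed.

Section Symmetry.
Variables (F : fieldType) (d : nat).

Lemma lauricellaC_perm (s : 'S_d) k (a b : F) (c x : 'I_d -> F) :
  lauricellaC_upto k a b (c \o s) (x \o s) = lauricellaC_upto k a b c x.
Proof.
pose f (v : {ffun 'I_d -> 'I_k.+1}) := [ffun j => v (s j)].
have f_inj : injective f.
  move=> v v' /ffunP eq_f; apply/ffunP => j.
  by have := eq_f (s^-1%g j); rewrite !ffunE permKV.
have sum_f v : (\sum_j f v j = \sum_j v j)%N.
  rewrite [RHS](reindex_inj (@perm_inj _ s)).
  by apply: eq_bigr => j _; rewrite ffunE.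
rewrite /lauricellaC_upto [LHS](reindex_inj f_inj) /=.
apply: eq_big => [v|v _]; first by rewrite sum_f.
rewrite /lauricellaC_term sum_f.
rewrite [in RHS](reindex_inj (@perm_inj _ s) (P := xpredT)
  (F := fun j => pochhammer (c j) (v j))).
rewrite [in RHS](reindex_inj (@perm_inj _ s) (P := xpredT)
  (F := fun j => x j ^+ v j / (v j)`!%:R)) /=.
by congr (_ / _ * _); apply: eq_bigr => j _; rewrite ffunE.
Qed.

Lemma torus_X_perm (h n : nat) (z z' : {ffun 'I_d -> nat}) :
  perm_eq [seq z j | j : 'I_d] [seq z' j | j : 'I_d] ->
  torus_X F h n z = torus_X F h n z'.
Proof.
pose t := [tuple z' j | j < d].
have -> : [seq z' j | j : 'I_d] = t by rewrite /= /image_mem enumT.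
case/tuple_permP => s zs; have zE j : z j = z' (s j).
  have := congr1 (nth 0%N ^~ j) zs.
  rewrite /= (nth_map j) ?size_enum_ord // nth_ord_enum.
  by rewrite (nth_map j) ?size_enum_ord // nth_ord_enum tnth_mktuple.
rewrite /torus_X /multinomial /gen_jacobi.
have -> : \prod_j (z j)`!%:R = \prod_j (z' j)`!%:R :> F.
  rewrite [RHS](reindex_inj (@perm_inj _ s)).
  by apply: eq_bigr => j _; rewrite zE.
have -> : \sum_j (z j)%:R = \sum_j (z' j)%:R :> F.
  rewrite [RHS](reindex_inj (@perm_inj _ s)).
  by apply: eq_bigr => j _; rewrite zE.
congr (_ + _ * (_ * _)); rewrite -[RHS](lauricellaC_perm s).
by congr lauricellaC_upto; apply/funext => j /=; rewrite zE.
Qed.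
End Symmetry.

Section Representations.
Variables (d : nat) (M : 'I_d -> nat).
Hypothesis M_gt0 : forall j, (0 < M j)%N.

Definition abs_coord (y : {ffun 'I_d -> int}) : {ffun 'I_d -> nat} :=
  [ffun j => (M j * `|y j|)%N].

Lemma codom_abs_coord y :
  [seq abs_coord y j | j : 'I_d] = [seq (M j * `|y j|)%N | j : 'I_d].
Proof. by apply: eq_codom => j; rewrite ffunE. Qed.

Lemma perm_codom_sum (z z' : 'I_d -> nat) :
  perm_eq [seq z j | j : 'I_d] [seq z' j | j : 'I_d] ->
  (\sum_j z j = \sum_j z' j)%N.
Proof.
move=> /(perm_big _) /= zz'; have := zz' nat addn 0%N xpredT id.
by rewrite !big_image.
Qed.

(** The representatives of z lie in the box, as each M_j |y_j| is at most |z|;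
so the multiplicity can be counted there. *)
Lemma torus_mult_count n (z : {ffun 'I_d -> nat}) : (\sum_j z j <= n)%N ->
  torus_mult M z =
  (\sum_(y <- int_box d n)
     perm_eq [seq z j | j : 'I_d] [seq abs_coord y j | j : 'I_d])%N.
Proof.
move=> le_zn; have fin := finite_torus_reps z M_gt0.
pose P (y : {ffun 'I_d -> int}) :=
  perm_eq [seq z j | j : 'I_d] [seq abs_coord y j | j : 'I_d].
rewrite -big_mkcond sum1_count -size_filter /torus_mult.
apply/perm_size/uniq_perm; rewrite ?fset_uniq ?filter_uniq ?int_box_uniq //.
move=> y; rewrite mem_filter -/(P y) in_fset_set //.
have -> : (y \in torus_reps M z) = P y.
  by apply/idP/idP; rewrite /P codom_abs_coord ?inE.
case Py: (P y) => //=; apply/esym/mem_int_box => j; apply: leq_trans le_zn.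
rewrite (perm_codom_sum Py) (bigD1 j) //= ffunE.
by rewrite (leq_trans (leq_pmull _ (M_gt0 j))) ?leq_addr.
Qed.

Lemma sorted_codom (z : {ffun 'I_d -> nat}) :
  (forall i j : 'I_d, (i <= j)%N -> (z j <= z i)%N) ->
  sorted geq [seq z j | j : 'I_d].
Proof.
move=> z_mono; apply: (homo_sorted (e := fun i j : 'I_d => (i <= j)%N)) => //.
have := iota_sorted 0 d; rewrite -val_enum_ord sorted_map.
by apply: sub_sorted.
Qed.

Definition sort_coord (z : {ffun 'I_d -> nat}) : {ffun 'I_d -> nat} :=
  [ffun j : 'I_d => nth 0%N (sort geq [seq z j | j : 'I_d]) j].

Lemma codom_sort_coord z :
  [seq sort_coord z j | j : 'I_d] = sort geq [seq z j | j : 'I_d].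
Proof.
apply: (@eq_from_nth _ 0%N) => [|i].
  by rewrite size_sort !size_map.
rewrite size_image card_ord => lt_id.
rewrite (nth_map (Ordinal lt_id)) ?size_enum_ord // ffunE.
by rewrite nth_enum_ord.
Qed.

Lemma nonincreasing_perm_eq (z z' : {ffun 'I_d -> nat}) :
  (forall i j : 'I_d, (i <= j)%N -> (z j <= z i)%N) ->
  (forall i j : 'I_d, (i <= j)%N -> (z' j <= z' i)%N) ->
  perm_eq [seq z j | j : 'I_d] [seq z' j | j : 'I_d] -> z = z'.
Proof.
move=> z_mono z'_mono zz'.
have eq_codom : [seq z j | j : 'I_d] = [seq z' j | j : 'I_d].
  apply: (sorted_eq (leT := geq)) zz'; try exact: sorted_codom.
    by move=> a b c /= ab ca; apply: leq_trans ab.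
  by move=> a b /= /andP[ab ba]; apply/eqP; rewrite eqn_leq ab ba.
apply/ffunP => j; have := congr1 (nth 0%N ^~ j) eq_codom.
by rewrite /= !nth_codom_ord.
Qed.

(** Double counting of the pairs (z, y) with y a representative of z: each y for
which the M_j |y_j| add up to h represents exactly one element of R(h), their
nonincreasing rearrangement, and [torus_X] does not see the order. *)
Lemma sum_torus_R (F : fieldType) n h : (h <= n)%N ->
  \sum_(z \in torus_R M h) (torus_mult M z)%:R * torus_X F h n z =
  \sum_(y <- int_box d n | l1norm (fun j => (M j)%:Z * y j) == h)
     torus_X F h n (abs_coord y).
Proof.
move=> le_hn; have fin := finite_torus_R M h.
rewrite fsbig_finite //=.
pose P (y : {ffun 'I_d -> int}) (z : {ffun 'I_d -> nat}) :=
  perm_eq [seq z j | j : 'I_d] [seq abs_coord y j | j : 'I_d].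
transitivity (\sum_(z <- fset_set (torus_R M h)) \sum_(y <- int_box d n)
    (P y z)%:R * torus_X F h n z).
  rewrite big_seq [RHS]big_seq; apply: eq_bigr => z.
  rewrite in_fset_set // inE => -[_ sum_z _].
  by rewrite (torus_mult_count (n := n)) ?sum_z // natr_sum mulr_suml.
have l1normE (y : {ffun 'I_d -> int}) :
    l1norm (fun j => (M j)%:Z * y j) = (\sum_j abs_coord y j)%N.
  by apply: eq_bigr => j _; rewrite abszM ffunE.
rewrite exchange_big [RHS]big_mkcond /=; apply: eq_bigr => y _.
rewrite l1normE; case: eqP => [sum_y|sum_y]; last first.
  rewrite big_seq big1 // => z; rewrite in_fset_set // inE => -[_ sum_z _].
  case Pyz: (P y z); rewrite ?mul0r //; case: sum_y.
  by rewrite -(perm_codom_sum Pyz).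
pose z0 := sort_coord (abs_coord y).
have Pz0 : P y z0 by rewrite /P codom_sort_coord perm_sort.
have z0_mono : forall i j : 'I_d, (i <= j)%N -> (z0 j <= z0 i)%N.
  move=> i j le_ij; rewrite !ffunE.
  have srt : sorted geq (sort geq [seq abs_coord y j | j : 'I_d]).
    by apply: sort_sorted => a b; exact: leq_total.
  have geq_tr : transitive geq by move=> a b c /= ab ca; apply: leq_trans ab.
  by apply: (sorted_leq_nth geq_tr leqnn 0%N srt) => //;
    rewrite inE size_sort size_image card_ord.
have z0R : z0 \in fset_set (torus_R M h).
  rewrite in_fset_set // inE; split=> //.
    by rewrite -sum_y; exact: perm_codom_sum Pz0.
  by exists y; move: Pz0; rewrite /P codom_abs_coord.
rewrite (bigD1_seq z0) ?fset_uniq //= Pz0 mul1r big_seq_cond big1 ?addr0.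
  exact: torus_X_perm.
move=> z /andP[]; rewrite in_fset_set // inE => -[z_mono _ _] /eqP z_neq.
case Pyz: (P y z); rewrite ?mul0r //; case: z_neq.
apply: nonincreasing_perm_eq => //; apply: perm_trans Pyz _.
by rewrite perm_sym.
Qed.
End Representations.

(** * The counting formula for the discrete torus *)

Theorem theorem1p1 (R : realFieldType) (d : nat) (M : 'I_d -> nat)
    (d_gt0 : (0 < d)%N) (M_ge3 : forall j : 'I_d, (3 <= M j)%N)
    (n : nat) (n_ge3 : (3 <= n)%N) :
  (Ncycles M n)%:R =
  (\prod_(j < d) M j)%N%:R *
    \sum_(0 <= h < n.+1 | h == n %[mod 2])
      \sum_(z \in torus_R M h)
        (torus_mult M z)%:R * torus_X R h n z :> R.
Proof.
have M_gt0 j : (0 < M j)%N by have := M_ge3 j; lia.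
pose q := d.*2.-1; have qS : q.+1 = d.*2 by rewrite /q; lia.
have qE : q%:R = 2 * d%:R - 1 :> R.
  by apply/eqP; rewrite eq_sym subr_eq natr1 qS -muln2 natrM mulrC.
have q_neq0 : q%:R != 0 :> R by rewrite pnatr_eq0 /q; lia.
pose Y := int_box d n.
pose My (y : {ffun 'I_d -> int}) := fun j => (M j)%:Z * y j.
have torus_XE h y : torus_X R h n (abs_coord M y) =
    (h == 0%N)%:R * (q%:R - 1) + walk_weight q%:R n h (fun j => `|My y j|%N).
  rewrite /torus_X /walk_weight qE; congr (_ + _); first by ring.
  have -> : 2 * d%:R - 3 = 2 * d%:R - 1 - 2 :> R by ring.
  have -> : (fun j => `|My y j|%N) = abs_coord M y.
    by apply/funext => j; rewrite /My abszM ffunE.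
  by congr (_ * gen_jacobi _ _ _ _); apply/funext => j; rewrite ffunE abszM.
have -> : (Ncycles M n)%:R = (\prod_(j < d) M j)%:R *
    (\sum_(y <- Y) (if (l1norm (My y) <= n)%N && (l1norm (My y) == n %[mod 2])
       then walk_weight q%:R n (l1norm (My y)) (fun j => `|My y j|%N) else 0)
     + (~~ odd n)%:R * (q%:R - 1)) :> R.
  case: n n_ge3 @Y torus_XE => [|[|n]] // _ Y _.
  rewrite /Ncycles (num_reduced_cycles_regular R n (q := q)); first last.
  - by move=> x; rewrite torus_reg // qS.
  - exact: torus_irr.
  - exact: torus_sym.
  rewrite mulrDr; congr (_ + _); last by rewrite card_torus //= negbK; ring.
  under eq_bigr => k _.
    rewrite (torus_closed_walks_int _ _ (n := n.+2)) ?leq_subr //.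
    rewrite mulrCA mulr_sumr.
  over.
  rewrite -mulr_sumr exchange_big; congr (_ * _); apply: eq_bigr => y _.
  by rewrite sum_dickson_walks.
congr (_ * _); rewrite big_mkord.
under [RHS]eq_bigr => h _ do rewrite (sum_torus_R _ _ (n := n)) -1?ltnS //.
rewrite (exchange_big_dep xpredT) //=.
(* The correction for even n is attached to the point y = 0, the only one of
   norm 0, where it becomes the Kronecker delta of [torus_X]. *)
have -> : (~~ odd n)%:R * (q%:R - 1) = \sum_(y <- Y)
    (if (l1norm (My y) <= n)%N && (l1norm (My y) == n %[mod 2])
     then (l1norm (My y) == 0%N)%:R * (q%:R - 1) else 0) :> R.
  have l1norm0 (y : {ffun 'I_d -> int}) :
      (l1norm (My y) == 0%N) = (y == [ffun=> 0]).
    rewrite sum_nat_eq0; apply/forallP/eqP => [y0|-> j].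
      apply/ffunP => j; rewrite ffunE; have := y0 j; rewrite /My /=.
      by rewrite abszM muln_eq0 !absz_eq0; have := M_gt0 j; lia.
    by rewrite /My ffunE mulr0.
  have Y0 : [ffun=> 0] \in Y by apply: mem_int_box => j; rewrite ffunE.
  rewrite (bigD1_seq [ffun=> 0]) ?int_box_uniq //= [X in _ = _ + X]big1 ?addr0.
    have /eqP -> : l1norm (My [ffun=> 0]) == 0%N by rewrite l1norm0.
    by rewrite /= mod0n modn2; case: (odd n); rewrite ?mul0r ?mul1r.
  by move=> y /negPf; rewrite -l1norm0 => ->; rewrite mul0r if_same.
rewrite -big_split /=; apply: eq_bigr => y _.
case: ifPn => [/andP[le_yn mod_y]|no_h].
  rewrite (big_pred1 (Ordinal (le_yn : (l1norm (My y) < n.+1)%N))) => [|h].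
    by rewrite torus_XE addrC.
  by rewrite /= -val_eqE /=; apply/andP/eqP => [[_ /eqP <-]|->].
rewrite addr0 big_pred0 // => h; apply/negP => /andP[h_mod /eqP y_h].
by case/negP: no_h; rewrite /My y_h h_mod -ltnS ltn_ord.
Qed.
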